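(* For every integer $b \ge 2$, there are only finitely many Munchausen numbers in base $b$; that is, the set of positive integers $n$ with $n = \theta_b(n)$ is finite.
   Context: Natural numbers are positive integers. For an integer $b \ge 2$ and a positive integer $n$, the base $b$ representation of $n$ is $[c_{m-1}, c_{m-2}, \ldots, c_0]_b$, where $0 \le c_i < b$ for all $i \in \{0,\ldots,m-1\}$, $n = \sum_{i=0}^{m-1} c_i b^i$, and there are no leading zeros ($c_{m-1} \neq 0$). Define $\theta_b(n) = \sum_{i=0}^{m-1} c_i^{c_i}$, with the convention $0^0 = 1$. A positive integer $n$ is called a Munchausen number in base $b$ if and only if $n = \theta_b(n)$. *)

(* Defs.v *)
From mathcomp Require Import all_boot.

Set Implicit Arguments.
Unset Strict Implicit.
Unset Printing Implicit Defensive.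

(* Sequences of digits are little-endian: c = [:: c_0; ...; c_{m-1}], so that
   [last 0 c] is the leading digit c_{m-1}. *)
Definition is_base_repr (b n : nat) (c : seq nat) : Prop :=
  [/\ all (fun d => d < b) c,
      n = \sum_(i < size c) nth 0 c i * b ^ i
    & last 0 c != 0].

(* An explicit form of the base b representation: [is_base_reprP] below shows
   that for 1 < b and 0 < n it is the unique c with [is_base_repr b n c]. *)
Definition digits (b n : nat) : seq nat :=
  mkseq (fun i => n %/ b ^ i %% b) (trunc_log b n).+1.

Lemma sum_modn_digits (b n m : nat) :
  \sum_(i < m) (n %/ b ^ i %% b) * b ^ i = n %% b ^ m.
Proof.
elim: m => [|m IH]; first by rewrite big_ord0 expn0 modn1.
rewrite big_ord_recr /= IH modn_divl -expnS.
rewrite [in RHS](divn_eq (n %% b ^ m.+1) (b ^ m)) addnC modn_dvdm //.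
by rewrite expnS dvdn_mull.
Qed.

Lemma digit_sum_lt (b : nat) (c : seq nat) : 1 < b ->
  all (fun d => d < b) c ->
  \sum_(i < size c) nth 0 c i * b ^ i < b ^ size c.
Proof.
move=> b1; elim: c => [|d c IH] /=; first by rewrite big_ord0.
case/andP=> db /IH {}IH; rewrite big_ord_recl /= expn0 muln1.
under eq_bigr => i _ do rewrite /bump /= add1n expnS mulnCA.
rewrite -big_distrr /= expnS.
apply: (@leq_trans (b * (\sum_(i < size c) nth 0 c i * b ^ i).+1)).
  by rewrite mulnS ltn_add2r.
by rewrite leq_mul2l IH orbT.
Qed.

Lemma nth_digit_sum (b : nat) (c : seq nat) (j : nat) : 1 < b ->
  all (fun d => d < b) c ->
  (\sum_(i < size c) nth 0 c i * b ^ i) %/ b ^ j %% b = nth 0 c j.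
Proof.
move=> b1; elim: c j => [|d c IH] j /=.
  by rewrite big_ord0 div0n mod0n nth_nil.
case/andP=> db cb; rewrite big_ord_recl /= expn0 muln1.
under eq_bigr => i _ do rewrite /bump /= add1n expnS mulnCA.
rewrite -big_distrr /= addnC mulnC.
case: j => [|j] /=; first by rewrite expn0 divn1 modnMDl modn_small.
by rewrite expnS divnMA divnMDl ?(ltnW b1) // (divn_small db) addn0 IH.
Qed.

Lemma is_base_reprP (b n : nat) (c : seq nat) : 1 < b -> 0 < n ->
  is_base_repr b n c <-> c = digits b n.
Proof.
move=> b1 n0; split=> [[cb nE cl]|->].
  have c0 : 0 < size c by case: c cl {cb nE}.
  have sz : trunc_log b n = (size c).-1.
    apply: trunc_log_eq => //; rewrite prednK // {2}nE digit_sum_lt // andbT.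
    have c1 : (size c).-1 < size c by rewrite prednK.
    rewrite nE (bigD1 (Ordinal c1)) //= nth_last.
    by apply: leq_trans (leq_addr _ _); rewrite leq_pmull // lt0n.
  apply: (@eq_from_nth _ 0) => [|i ic]; first by rewrite size_mkseq sz prednK.
  by rewrite nth_mkseq ?sz ?prednK // nE nth_digit_sum.
split.
- by apply/allP=> d /mapP[i _ ->]; rewrite ltn_mod ltnW.
- rewrite size_mkseq; under eq_bigr => i _ do rewrite nth_mkseq //.
  by rewrite sum_modn_digits modn_small // trunc_log_ltn.
- rewrite -nth_last size_mkseq nth_mkseq //= -lt0n modn_small.
    by rewrite divn_gt0 ?expn_gt0 ?(ltnW b1) // trunc_logP.
  by rewrite ltn_divLR ?expn_gt0 ?(ltnW b1) // -expnS trunc_log_ltn.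
Qed.

(* In ssrnat, [0 ^ 0] is [1], so a digit 0 contributes 1. *)
Definition theta (b n : nat) : nat := \sum_(c <- digits b n) c ^ c.

Definition munchausen (b n : nat) : Prop := 0 < n /\ n = theta b n.

(* Main.v *)
Require Import Defs.
From mathcomp Require Import all_boot.
From mathcomp Require Import classical_sets cardinality.
From mathcomp Require Import zify.

(* A number with k + 1 digits is at least b ^ k >= 2 ^ k, whereas theta is at
   most (k + 1) * b ^ b. As (k + 1) ^ 2 <= 4 * 2 ^ k, a Munchausen number n
   satisfies n ^ 2 <= 4 * n * (b ^ b) ^ 2. *)

Set Implicit Arguments.
Unset Strict Implicit.
Unset Printing Implicit Defensive.

Local Open Scope classical_set_scope.

(** [theta] grows only logarithmically in [n]. Squaring [theta_le] turns the logarithmic factor into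
    a linear one, and cancelling [n] in [munchausen_le] leaves a bound depending on [b] alone. *)

Lemma sqrn_succ_le_exp2 (k : nat) : k.+1 ^ 2 <= 4 * 2 ^ k.
Proof.
elim: k => [|[|[|k]] IH] //.
rewrite (expnS 2 k.+2) mulnCA.
apply: leq_trans (leq_mul (leqnn 2) IH).
(* [(m + 2) ^ 2 <= 2 * (m + 1) ^ 2] holds only from [m = 2] on, hence the separate small cases. *)
lia.
Qed.

Lemma theta_le (b n : nat) : 0 < b -> theta b n <= (trunc_log b n).+1 * b ^ b.
Proof.
move=> b0; rewrite /theta /digits big_map -[X in _ <= X * _](size_iota 0).
rewrite -sum1_size big_distrl /=; apply: leq_sum => i _; rewrite mul1n.
have db : n %/ b ^ i %% b < b by rewrite ltn_mod.
(* For a digit [d], [d ^ d <= b ^ d <= b ^ b]; at [d = 0] the first step is [0 ^ 0 = b ^ 0]. *)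
apply: leq_trans (leq_pexp2l b0 (ltnW db)).
by case: (n %/ b ^ i %% b) db => // d db; rewrite leq_exp2r // ltnW.
Qed.

Lemma munchausen_le (b n : nat) : 1 < b -> munchausen b n ->
  n <= 4 * (b ^ b) ^ 2.
Proof.
move=> b1 [n0 nE]; have b0 := ltnW b1.
set k := trunc_log b n.
have kn : 2 ^ k <= n.
  apply: leq_trans (trunc_logP b1 n0); rewrite -/k.
  by case: (k) => // j; rewrite leq_exp2r.
rewrite -(leq_pmul2l n0) mulnn.
apply: (@leq_trans ((k.+1 * b ^ b) ^ 2)).
  by rewrite leq_sqr {1}nE theta_le.
rewrite expnMn mulnCA mulnA leq_mul2r.
by rewrite (leq_trans (sqrn_succ_le_exp2 k)) ?orbT // leq_mul2l kn orbT.
Qed.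

Theorem proposition3 (b : nat) (hb : (2 <= b)%N) :
  finite_set [set n : nat | munchausen b n].
Proof.
apply: sub_finite_set (finite_II (4 * (b ^ b) ^ 2).+1) => n /= nM.
by rewrite ltnS munchausen_le.
Qed.
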